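(* Let $q$ be a transcendental complex number. Let $r$ and $s$ be integers with $s\neq 0$, and set $\alpha:=r/s$. Let $b$ be a positive integer, and set $c:=\gcd(r,s,b)$, $b':=b/c$ and $s':=s/c$. Let $n\in\mathbb Z$ be such that $(q^r;q^s)_n$ is well-defined and non-zero. Then $$ v_{\phi_b}\big((q^r;q^s)_n\big)=\begin{cases}\left\lfloor \dfrac{cn}{b}- D_{b'}(\alpha)-\dfrac{\lfloor 1-\alpha\rfloor}{b'}\right\rfloor+1 & \text{if } \gcd(s',b')=1,\\[2mm] 0 & \text{otherwise.}\end{cases} $$
   Context: For integers $r,s$ with $s\neq0$, the $q$-Pochhammer symbol is $(q^r;q^s)_n:=\prod_{i=0}^{n-1}(1-q^{r+si})$ for $n\geq 0$ (empty product $=1$ for $n=0$), and for $n<0$ it is $(q^r;q^s)_n:=\prod_{i=1}^{-n}\frac{1}{1-q^{r-is}}$, which is well-defined when no factor $1-q^{r-is}$ vanishes. For a positive integer $b$, $\phi_b(q)\in\mathbb Z[q]$ is the $b$-th cyclotomic polynomial and $v_{\phi_b}$ is the associated valuation on $\mathbb Q(q)$: for nonzero $R\in\mathbb Z[q]$, $v_{\phi_b}(R)$ is the largest $\nu\geq0$ with $\phi_b^\nu\mid R$, extended by $v_{\phi_b}(R/S)=v_{\phi_b}(R)-v_{\phi_b}(S)$. Generalized Dwork map: for a positive integer $m$, let $S_m^{-1}\mathbb Z$ be the set of rationals whose reduced denominator is coprime to $m$; for $\alpha\in S_m^{-1}\mathbb Z$, $D_m(\alpha)$ is the unique element of $S_m^{-1}\mathbb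 Z$ such that $mD_m(\alpha)-\alpha\in\{0,1,\dots,m-1\}$. (When $\gcd(s',b')=1$, $\alpha\in S_{b'}^{-1}\mathbb Z$.) *)

(* Defs.v *)
From HB Require Import structures.
From mathcomp Require Import all_boot all_order all_algebra.
From mathcomp Require Export complex cyclotomic.
From mathcomp Require Export boolp classical_sets reals.
Set Implicit Arguments.
Unset Strict Implicit.
Unset Printing Implicit Defensive.
Import Order.TTheory GRing.Theory Num.Theory.
Local Open Scope ring_scope.

Definition transcendental (R : realType) (q : R[i]) : Prop :=
  ~ algebraicOver (ratr : rat -> R[i]) q.

(* (q^r; q^s)_n for n : int.  [Negz m] is the integer -(m+1), so the product of
   inverses runs over 1 <= i <= m+1 = -n. *)
Definition qpoch (F : fieldType) (q : F) (r s n : int) : F :=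
  match n with
  | Posz m => \prod_(0 <= i < m) (1 - q ^ (r + s * i%:Z))
  | Negz m => \prod_(1 <= i < m.+2) (1 - q ^ (r - i%:Z * s))^-1
  end.

(* Vacuous for n >= 0.  Needed because x^-1 is total, with 0^-1 = 0. *)
Definition qpoch_defined (F : fieldType) (q : F) (r s n : int) : Prop :=
  forall i : nat, 1 <= i%:Z <= - n -> 1 - q ^ (r - i%:Z * s) != 0.

Definition dvd_phi_exp (b : nat) (P : {poly int}) (nu : nat) : Prop :=
  exists Q : {poly int}, P = 'Phi_b ^+ nu * Q.

(* Largest nu such that 'Phi_b ^+ nu divides P in Z[X]; it exists when P != 0
   and b > 0 (the default value 0 is used otherwise). *)
Definition vphi_poly (b : nat) (P : {poly int}) : nat :=
  xget 0%N [set nu : nat | dvd_phi_exp b P nu /\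
                           forall mu : nat, dvd_phi_exp b P mu -> (mu <= nu)%N].

Definition zpoly_eval (F : fieldType) (q : F) (P : {poly int}) : F :=
  (map_poly intr P).[q].

(* The valuation on the subfield Q(q) of F, for q transcendental over Q: then
   P |-> P(q) identifies Z[X] with Z[q], every x <> 0 in Q(q) is P(q) / S(q)
   with P, S != 0, and v(P) - v(S) only depends on x.  The default value 0 is
   used when x = 0 or x is not in Q(q). *)
Definition vphi (F : fieldType) (q : F) (b : nat) (x : F) : int :=
  xget 0 [set v : int | exists P S : {poly int},
    [/\ P != 0, S != 0, x = zpoly_eval q P / zpoly_eval q S
      & v = (vphi_poly b P)%:Z - (vphi_poly b S)%:Z]].

Definition Sinv (m : nat) : set rat :=
  [set x : rat | coprime `|denq x|%N m].

(* For m > 0 and alpha in Sinv m there is exactly one such x (the default value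
   0 is used otherwise). *)
Definition dwork (m : nat) (alpha : rat) : rat :=
  xget 0 [set x : rat | Sinv m x /\
    exists k : nat, (k < m)%N /\ m%:R * x - alpha = k%:R].

(* Main.v *)
(* Let z be a primitive b-th root of unity.  As 'Phi_b is the monic minimal
   polynomial of z, it divides P in Z[X] exactly when P(z) = 0, so the valuation
   is additive, and 1 - X^m (m > 0), whose roots are simple, has valuation 1 if
   b | m and 0 otherwise.  Hence the valuation of (q^r; q^s)_n is the signed
   number of i between 0 and n with b | r + s i.  Writing r = c r', s = c s' and
   b = c b', this means b' | r' + s' i, which has no solution if s' and b' are
   not coprime.  Otherwise it means i = k mod b', where
   k = b' D_{b'}(alpha) - alpha lies in [0, b'), so the signed number is
   floor ((n - 1 - k) / b') + 1; since alpha + floor (1 - alpha) lies in (0, 1],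
   this is the stated formula. *)
Require Import Defs.
From mathcomp Require Import all_boot all_order all_algebra.
From mathcomp Require Import algC ring lra zify.
Set Implicit Arguments.
Unset Strict Implicit.
Unset Printing Implicit Defensive.
Import Order.TTheory GRing.Theory Num.Theory.
Local Open Scope ring_scope.

(** * Powers of ['Phi_b] in integer polynomials *)

Section CyclotomicValuation.
Variable b : nat.
Variable z : algC.
Hypothesis prim_z : b.-primitive_root z.

Local Notation pZtoC := (map_poly (intr : int -> algC)).

Lemma root_Phi_prim : root (pZtoC 'Phi_b) z.
Proof. by rewrite (Cintr_Cyclotomic prim_z) root_cyclotomic. Qed.

(** As ['Phi_b] is monic, division by it stays in Z[X]. The remainder vanishes at [z] and is smaller
    than the minimal polynomial of [z] over Q, which has the size of ['Phi_b], so it is zero. *)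
Lemma Phi_dvd_root (P : {poly int}) :
  root (pZtoC P) z -> exists Q, P = 'Phi_b * Q.
Proof.
move=> Pz; have monPhi := Cyclotomic_monic b.
have DP := Pdiv.RingMonic.rdivp_eq monPhi P.
set Q := Pdiv.Ring.rdivp _ _ in DP; set T := Pdiv.Ring.rmodp _ _ in DP.
exists Q; suff T0 : T = 0 by rewrite {1}DP T0 addr0 mulrC.
have sT : (size T < size 'Phi_b)%N.
  by apply: Pdiv.Ring.ltn_rmodpN0; apply: monic_neq0.
have Tz : root (pZtoC T) z.
  move: Pz; rewrite {1}DP rmorphD rmorphM /root hornerD hornerM.
  by rewrite (rootP root_Phi_prim) mulr0 add0r.
have [p [Dp _] dvp] := minCpolyP z.
have sp : size p = size 'Phi_b.
  rewrite -(size_map_poly (ratr : {rmorphism rat -> algC})) -Dp.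
  rewrite (minCpoly_cyclotomic prim_z) -(Cintr_Cyclotomic prim_z).
  by rewrite size_map_inj_poly //; apply: intr_inj.
have ET : map_poly (ratr : rat -> algC) (map_poly intr T) = pZtoC T.
  by rewrite -map_poly_comp; apply: eq_map_poly => a /=; rewrite rmorph_int.
move: Tz; rewrite -ET dvp => pT.
have sT' : size (map_poly (intr : int -> rat) T) = size T.
  by rewrite size_map_inj_poly //; apply: intr_inj.
apply/eqP; rewrite -size_poly_eq0 -sT' size_poly_eq0.
apply: contraLR sT => nzT; rewrite -leqNgt -sp -sT'.
exact: dvdp_leq.
Qed.

Lemma vphi_poly_decomp (P : {poly int}) : P != 0 ->
  exists v Q, P = 'Phi_b ^+ v * Q /\ ~~ root (pZtoC Q) z.
Proof.
elim: {P}(size P) {-2}P (leqnn (size P)) => [|m IHm] P sP nzP.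
  by move: sP; rewrite leqn0 size_poly_eq0 (negPf nzP).
have [Pz|nPz] := boolP (root (pZtoC P) z); last first.
  by exists 0%N, P; rewrite expr0 mul1r.
have [Q DP] := Phi_dvd_root Pz.
have nzQ : Q != 0 by apply: contraNneq nzP => Q0; rewrite DP Q0 mulr0.
have b_gt0 := prim_order_gt0 prim_z.
have sQ : (size Q < size P)%N.
  rewrite DP size_monicM ?Cyclotomic_monic // size_Cyclotomic addSn /=.
  by rewrite -[X in (X < _)%N]add0n ltn_add2r totient_gt0.
have [v [T [DQ nTz]]] := IHm Q (leq_trans sQ sP) nzQ.
by exists v.+1, T; rewrite DP DQ exprS mulrA.
Qed.

(** Cancelling ['Phi_b ^+ v] from a factorisation with a higher power would leave ['Phi_b] as a
    factor of [Q], making [z] a root. With [vphi_poly_decomp], this replaces the choice in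
    [vphi_poly] by a test at [z]. *)
Lemma vphi_polyE (v : nat) (Q : {poly int}) :
  ~~ root (pZtoC Q) z -> vphi_poly b ('Phi_b ^+ v * Q) = v.
Proof.
move=> nQz; have maxv mu : dvd_phi_exp b ('Phi_b ^+ v * Q) mu -> (mu <= v)%N.
  move=> [T]; rewrite leqNgt => DT; apply/negP => lt_v.
  case/negP: nQz; suff -> : Q = 'Phi_b ^+ (mu - v.+1) * T * 'Phi_b.
    by rewrite rmorphM rootM root_Phi_prim orbT.
  have nzPhi : 'Phi_b ^+ v != 0 by rewrite expf_neq0 // monic_neq0 // Cyclotomic_monic.
  apply: (mulfI nzPhi); rewrite DT -{1}(subnKC lt_v) addSnnS exprD exprS.
  by ring.
rewrite /vphi_poly; apply: xget_unique => [|w [Dw maxw]].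
  by split=> //; exists Q.
by apply/eqP; rewrite eqn_leq maxv //= maxw //; exists Q.
Qed.

Lemma vphi_polyM (P S : {poly int}) : P != 0 -> S != 0 ->
  vphi_poly b (P * S) = (vphi_poly b P + vphi_poly b S)%N.
Proof.
move=> /vphi_poly_decomp[v [Q [-> nQz]]] /vphi_poly_decomp[w [T [-> nTz]]].
rewrite mulrACA -exprD !vphi_polyE // rmorphM rootM negb_or.
exact/andP.
Qed.

Lemma vphi_poly_nroot (P : {poly int}) :
  ~~ root (pZtoC P) z -> vphi_poly b P = 0%N.
Proof. by move=> nPz; rewrite -[P]mul1r -(expr0 'Phi_b) vphi_polyE. Qed.

(* [1 - X^k] has nonzero derivative at z, hence no multiple factor. *)
Lemma vphi_poly_subXn (k : nat) : (0 < k)%N ->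
  vphi_poly b (1 - 'X^k) = (b %| k)%N.
Proof.
move=> k_gt0.
have EX : pZtoC (1 - 'X^k) = 1 - 'X^k by rewrite rmorphB rmorph1 /= map_polyXn.
have rootE : root (pZtoC (1 - 'X^k)) z = (b %| k)%N.
  by rewrite EX /root !hornerE subr_eq0 eq_sym (prim_order_dvd prim_z).
have [bk|nbk] := boolP (b %| k)%N; last by rewrite vphi_poly_nroot // rootE.
have [Q DQ] : exists Q, 1 - 'X^k = 'Phi_b * Q by apply: Phi_dvd_root; rewrite rootE.
rewrite DQ -['Phi_b]expr1 vphi_polyE //; apply/negP => /rootP Qz.
have := congr1 (fun p => p^`().[z]) (congr1 pZtoC DQ).
rewrite EX rmorphM derivM !derivE !hornerE Qz (rootP root_Phi_prim).
rewrite mulr0 mul0r addr0 => /eqP.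
rewrite oppr_eq0 hornerMn hornerXn mulrn_eq0 eqn0Ngt k_gt0 expf_eq0.
by rewrite (prim_root_eq0 prim_z) eqn0Ngt (prim_order_gt0 prim_z) andbF.
Qed.

(** * The valuation on rational expressions in [q] *)

Variables (F : fieldType) (q : F).
Hypothesis q_transc : forall P : {poly int}, P != 0 -> zpoly_eval q P != 0.

(** The relation from which [vphi] chooses: explicit fractions can be multiplied and inverted, and
    [vphi_eq] returns to the chosen value. *)
Definition has_vphi (x : F) (v : int) : Prop := exists P S : {poly int},
  [/\ P != 0, S != 0, x = zpoly_eval q P / zpoly_eval q S
    & v = (vphi_poly b P)%:Z - (vphi_poly b S)%:Z].

Lemma zpoly_evalM (P S : {poly int}) :
  zpoly_eval q (P * S) = zpoly_eval q P * zpoly_eval q S.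
Proof. by rewrite /zpoly_eval rmorphM hornerM. Qed.

Lemma zpoly_eval1 : zpoly_eval q 1 = 1.
Proof. by rewrite /zpoly_eval rmorph1 hornerC. Qed.

Lemma zpoly_eval_inj : injective (zpoly_eval q).
Proof.
move=> P S ePS; apply/eqP; rewrite -subr_eq0; apply: contraT => /q_transc.
by rewrite /zpoly_eval rmorphB hornerD hornerN -!/(zpoly_eval _ _) ePS subrr eqxx.
Qed.

(** Cross-multiplying two fractions for [x] gives an equality in Z[X], by injectivity of evaluation
    at [q]; additivity of [vphi_poly] then applies. *)
Lemma has_vphi_unique (x : F) (v w : int) :
  has_vphi x v -> has_vphi x w -> v = w.
Proof.
move=> [P [S [nzP nzS -> ->]]] [P' [S' [nzP' nzS' + ->]]].
move/eqP; rewrite eqr_div ?q_transc // -!zpoly_evalM => /eqP/zpoly_eval_inj.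
by move/(congr1 (vphi_poly b)); rewrite !vphi_polyM //; lia.
Qed.

Lemma vphi_eq (x : F) (v : int) : has_vphi x v -> vphi q b x = v.
Proof.
by move=> xv; apply: xget_unique => // w /has_vphi_unique; apply.
Qed.

Lemma has_vphiM (x y : F) (v w : int) :
  has_vphi x v -> has_vphi y w -> has_vphi (x * y) (v + w).
Proof.
move=> [P [S [nzP nzS -> ->]]] [P' [S' [nzP' nzS' -> ->]]].
exists (P * P'), (S * S'); split; rewrite ?mulf_neq0 //.
  by rewrite !zpoly_evalM mulf_div.
by rewrite !vphi_polyM //; lia.
Qed.

Lemma has_vphiV (x : F) (v : int) : has_vphi x v -> has_vphi x^-1 (- v).
Proof.
move=> [P [S [nzP nzS -> ->]]]; exists S, P; split=> //; last by rewrite opprB.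
by rewrite invf_div.
Qed.

Lemma has_vphi1 : has_vphi 1 0.
Proof.
exists 1, 1; split; rewrite ?oner_eq0 ?subrr //.
by rewrite zpoly_eval1 divr1.
Qed.

Lemma has_vphi_subX (m : int) :
  1 - q ^ m != 0 -> has_vphi (1 - q ^ m) (b%:Z %| m)%Z.
Proof.
have Xnz k : 'X^k != 0 :> {poly int} by rewrite monic_neq0 // monicXn.
have evalX k : zpoly_eval q 'X^k = q ^+ k.
  by rewrite /zpoly_eval map_polyXn hornerXn.
have evalB k : zpoly_eval q (1 - 'X^k) = 1 - q ^+ k.
  by rewrite /zpoly_eval rmorphB rmorph1 /= map_polyXn !hornerE.
have Bnz k : (0 < k)%N -> 1 - 'X^k != 0 :> {poly int}.
  move=> k_gt0; apply/eqP => /(congr1 (fun p : {poly int} => p`_0))/eqP.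
  by rewrite coefB coef1 coefXn coef0 (ltn_eqF k_gt0) subr0 oner_eq0.
case: m => [[|k]|k] nz.
- by rewrite expr0z subrr eqxx in nz.
- exists (1 - 'X^(k.+1)), 1; split; rewrite ?oner_eq0 ?Bnz //.
    by rewrite evalB zpoly_eval1 divr1.
  rewrite vphi_poly_subXn // (vphi_poly_nroot (P := 1)) ?subr0 //.
  by rewrite rmorph1 root1.
(* 1 - q^(-m) = (1 - q^m) / (- q^m) *)
exists (1 - 'X^(k.+1)), (- 'X^(k.+1)); split; rewrite ?oppr_eq0 ?Bnz //.
  have nzq : q ^+ k.+1 != 0 by rewrite -evalX q_transc.
  rewrite evalB /zpoly_eval rmorphN hornerN /= -/(zpoly_eval _ _) evalX.
  have -> : q ^ Negz k = (q ^+ k.+1)^-1 by [].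
  by rewrite invrN mulrN mulrBl mul1r divff // opprB.
(* The denominator has valuation 0 because [z] is non-zero. *)
rewrite vphi_poly_subXn // (vphi_poly_nroot (P := - _)) ?subr0 //.
rewrite rmorphN rootN /= map_polyXn /root hornerXn expf_eq0.
by rewrite (prim_root_eq0 prim_z) eqn0Ngt (prim_order_gt0 prim_z) andbF.
Qed.

(** [N] is the signed count of divisible exponents, given by its recurrence so that one closed form
    serves both signs of [n]. *)
Lemma has_vphi_qpoch (r s : int) (N : int -> int) (n : int) :
    N 0 = 0 -> (forall j, N (j + 1) = N j + (b%:Z %| r + s * j)%Z) ->
  qpoch q r s n != 0 -> has_vphi (qpoch q r s n) (N n).
Proof.
move=> N0 NS; case: n => [m|m] /=.
  elim: m => [|m IHm]; first by rewrite big_geq // N0 => _; apply: has_vphi1.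
  rewrite big_nat_recr //= mulf_eq0 negb_or => /andP[/IHm vm /has_vphi_subX v].
  by rewrite -addn1 PoszD NS; apply: has_vphiM.
(* Each inverted factor takes away the indicator at a negative index, which is the recurrence for
   [N] read backwards. Since [0^-1 = 0], a non-zero product makes every factor under an inverse
   non-zero. *)
rewrite NegzE; elim: m => [|m IHm].
  rewrite big_nat1 invr_eq0 => /has_vphi_subX/has_vphiV.
  congr has_vphi; have := NS (-1); rewrite addNr N0 mulrN1 mul1r => NSm.
  by rewrite -[LHS]add0r NSm addrK.
rewrite big_nat_recr //= mulf_eq0 negb_or invr_eq0.
move=> /andP[/IHm vm /has_vphi_subX/has_vphiV v].
have := has_vphiM vm v; congr has_vphi.
have -> : - m.+1%:Z = - m.+2%:Z + 1 by lia.
by rewrite NS mulrN [s * _]mulrC addrK.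
Qed.

End CyclotomicValuation.

(** * The Dwork map through a linear congruence *)

Lemma dvdz_denq_div (w s : int) : s != 0 -> (denq (w%:~R / s%:~R) %| s)%Z.
Proof.
move=> nzs; rewrite -(fracqE (w, s)) den_fracq nzs /dvdz /=.
apply/dvdnP; exists (gcdn `|w| `|s|); rewrite mulnC divnK ?dvdn_gcdr //.
Qed.

Lemma dwork_div (m : nat) (r s : int) : (0 < m)%N -> s != 0 -> coprimez s m ->
  exists2 k : nat, (k < m)%N /\ (m %| r + s * k)%Z
    & dwork m (r%:~R / s%:~R) = (r%:~R / s%:~R + k%:R) / m%:R.
Proof.
move=> m_gt0 nzs cop.
have nzm : m%:R != 0 :> rat by rewrite pnatr_eq0 -lt0n.
have nzsQ : s%:~R != 0 :> rat by rewrite intr_eq0.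
have nzmZ : m%:Z != 0 by lia.
have [k ltkm /dvdzP[w Dw]] : exists2 k : nat, (k < m)%N & (m %| r + s * k)%Z.
  have [u [v uv]] := Bezoutz s m.
  have k_ge0 := modz_ge0 (- u * r) nzmZ.
  (* From u s + v m = 1, the residue of - u r solves r + s k = 0 modulo [m]. *)
  exists `|(- u * r %% m)%Z|%N; first by have := ltz_mod (- u * r) nzmZ; lia.
  rewrite gez0_abs //; apply/dvdzP; exists (v * r - s * (- u * r %/ m)%Z).
  move: uv; rewrite (eqP cop) => uv.
  have -> : (- u * r %% m)%Z = - u * r - (- u * r %/ m)%Z * m.
    by rewrite {2}(divz_eq (- u * r) m) addrC addKr.
  by rewrite -[X in X + _]mulr1 -uv; ring.
exists k; first by split=> //; apply/dvdzP; exists w.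
set x := RHS.
(* The factor [m] cancels, so the denominator of [x] divides [s] and is coprime to [m]. *)
have Dx : x = w%:~R / s%:~R.
  have := congr1 (intr : int -> rat) Dw.
  rewrite rmorphD !rmorphM /= => E.
  apply: (mulIf nzm); rewrite /x mulfVK // mulrAC -[_ * m%:R]E.
  by field.
have copx : coprimez (denq x) m.
  rewrite coprimezE; apply: coprime_dvdl cop.
  by have := dvdz_denq_div w nzs; rewrite -Dx.
apply: xget_unique => [|y [ycop [k' [ltk' Dy]]]].
  split=> //; exists k; split=> //.
  by rewrite /x mulrC mulfVK // addrC addKr.
have mxy : m%:R * (y - x) = k'%:R - k%:R.
  by rewrite mulrBr /x [X in _ - X]mulrC mulfVK // -Dy; ring.
(* Uniqueness: clearing denominators coprime to [m] shows that [m] divides k' - k, and both lie in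
   [0, m). *)
have Dyx : (m%:Z * (numq y * denq x - numq x * denq y) =
            (k'%:Z - k%:Z) * (denq x * denq y)).
  apply: (@intr_inj rat); rewrite !(rmorphM, rmorphB) /=.
  have -> : (k'%:~R - k%:~R) = m%:R * (y - x) :> rat by [].
  by rewrite !numqE; ring.
have copd : coprimez m (denq x * denq y).
  by rewrite coprimezMr !(coprimez_sym m) copx.
have : (m %| k'%:Z - k%:Z)%Z by rewrite -(Gauss_dvdzl _ copd) -Dyx dvdz_mulr.
rewrite -eqz_mod_dvd !modz_nat !modn_small // => /eqP[Ek].
by apply: (mulfI nzm); apply/eqP; rewrite -subr_eq0 -mulrBr mxy Ek subrr.
Qed.

(** * Counting a residue class by floors *)

Lemma divzD1 (m : int) (d : nat) : (0 < d)%N ->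
  ((m + 1) %/ d)%Z = (m %/ d)%Z + (d %| m + 1)%Z.
Proof.
move=> d_gt0; have nzd : d%:Z != 0 by lia.
have m_ge := modz_ge0 m nzd; have m_lt := ltz_mod m nzd.
have Dm := divz_eq m d; have Dm1 := divz_eq (m + 1) d.
have m1_ge := modz_ge0 (m + 1) nzd; have m1_lt := ltz_mod (m + 1) nzd.
rewrite (sameP (dvdz_mod0P) eqP); case: eqP => /= E; nia.
Qed.

(** With e = floor(1 - a), the sum a + e lies in (0, 1], so the numerator n - k - (a + e) lies in [n
    - 1 - k, n - k). No multiple of [m] separates it from n - 1 - k. *)
Lemma floor_div_count (m : nat) (a : rat) (n k : int) : (0 < m)%N ->
  Num.floor (n%:~R / m%:R - (a + k%:~R) / m%:R - (Num.floor (1 - a))%:~R / m%:R)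
    = ((n - 1 - k) %/ m)%Z.
Proof.
move=> m_gt0; have nzm : m%:Z != 0 by lia.
have m_pos : 0 < m%:R :> rat by rewrite ltr0n.
apply: floor_def; rewrite -!mulrBl ler_pdivlMr // ltr_pdivrMr //.
have := floor_itv (1 - a); set e := Num.floor _ => /andP[e_le].
have := divz_eq (n - 1 - k) m; have := ltz_mod (n - 1 - k) nzm.
have := modz_ge0 (n - 1 - k) nzm.
set t := (_ %/ _)%Z; set u := (_ %% _)%Z => u_ge u_lt Dn.
have lo : t * m <= n - 1 - k by lia.
have hi : n - k <= (t + 1) * m by lia.
move: lo hi; rewrite -!(ler_int rat) !(rmorphM, rmorphB, rmorphD) /= => lo hi.
by move=> e_gt; apply/andP; split; lra.
Qed.


Theorem theorem1p1 (R : realType) (q : R[i]) (r s : int) (b : nat) (n : int)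
    (hq : transcendental q) (hs : s != 0) (hb : (0 < b)%N)
    (hdef : qpoch_defined q r s n) (hnz : qpoch q r s n != 0) :
  let alpha : rat := r%:~R / s%:~R in
  let c : nat := gcdn (gcdn `|r|%N `|s|%N) b in
  let b' : nat := (b %/ c)%N in
  let s' : int := (s %/ c%:Z)%Z in
  vphi q b (qpoch q r s n) =
    if coprimez s' b'%:Z then
      Num.floor (c%:R * n%:~R / b%:R - dwork b' alpha
                 - (Num.floor (1 - alpha))%:~R / b'%:R : rat) + 1
    else 0.
Proof.
move=> alpha c b' s'.
have c_gt0 : (0 < c)%N by rewrite gcdn_gt0 hb orbT.
have cb : (c %| b)%N by apply: dvdn_gcdr.
have cr : (c %| r)%Z by apply: dvdn_trans (dvdn_gcdl _ _) (dvdn_gcdl _ _).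
have cs : (c %| s)%Z by apply: dvdn_trans (dvdn_gcdl _ _) (dvdn_gcdr _ _).
have Db : b = (b' * c)%N by rewrite divnK.
have b'_gt0 : (0 < b')%N by move: hb; rewrite Db muln_gt0 => /andP[].
pose r' := (r %/ c)%Z.
have Dr : r = r' * c by rewrite divzK.
have Ds : s = s' * c by rewrite divzK.
have nzc : c%:Z != 0 by lia.
have dvdE j : (b %| r + s * j)%Z = (b' %| r' + s' * j)%Z.
  by rewrite Dr Ds Db PoszM mulrAC -mulrDl dvdz_mul2r.
have q_transc (P : {poly int}) : P != 0 -> zpoly_eval q P != 0.
  move=> nzP; apply/eqP => Pq; apply: hq; exists (map_poly intr P).
    by rewrite map_poly_eq0_id0 // intr_eq0 lead_coef_eq0.
  rewrite /root -map_poly_comp -Pq; apply/eqP; congr (_.[q]).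
  by apply: eq_map_poly => a /=; rewrite rmorph_int.
have [z prim_z] := C_prim_root_exists hb.
apply: (vphi_eq prim_z q_transc).
case: ifP => cop; last first.
  apply: (has_vphi_qpoch prim_z q_transc (N := fun=> 0)) => // j.
  rewrite dvdE; case: (boolP (_ %| _)%Z) => // dvd_j.
  case/negP: (negbT cop).
  (* A solution [j] makes [d] divide r' as well; then d c divides [r], [s] and [b], hence [c], so d
     = 1. *)
  pose d := gcdn `|s'| b'.
  have ds' : (d %| s')%Z by apply: dvdn_gcdl.
  have db' : (d %| b')%N by apply: dvdn_gcdr.
  have dr' : (d %| r')%Z.
    by rewrite -(rpredDr _ (dvdz_mulr j ds')) //; apply: dvdz_trans dvd_j.
  have Er : (d * c %| `|r|)%N by rewrite Dr abszM dvdn_mul.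
  have Es : (d * c %| `|s|)%N by rewrite Ds abszM dvdn_mul.
  have Eb : (d * c %| b)%N by rewrite Db dvdn_mul.
  have : (d * c %| gcdn (gcdn `|r| `|s|) b)%N by rewrite !dvdn_gcd Er Es Eb.
  by rewrite -/c -[X in (_ %| X)%N]mul1n dvdn_pmul2r // dvdn1.
have nzs' : s' != 0 by apply: contraNneq hs => s0; rewrite Ds s0 mul0r.
have Da : alpha = r'%:~R / s'%:~R.
  by rewrite /alpha Dr Ds !rmorphM /= -mulf_div divff ?mulr1 // intr_eq0.
have [k [ltk dvdk] Dk] := dwork_div r' b'_gt0 nzs' cop.
rewrite Da Dk -Da.
have -> : c%:R * n%:~R / b%:R = n%:~R / b'%:R :> rat.
  rewrite Db natrM; field.
  by rewrite !pnatr_eq0 -!lt0n c_gt0 b'_gt0.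
rewrite (floor_div_count alpha n k b'_gt0).
(* The final 1 normalises N 0 = 0: as 0 <= k < b', the quotient of - 1 - k is -1. *)
pose N (j : int) := ((j - 1 - k%:Z) %/ b')%Z + 1.
apply: (has_vphi_qpoch prim_z q_transc (N := N)) => // [|j]; rewrite /N.
  have -> : 0 - 1 - k%:Z = -1 * b'%:Z + (b'%:Z - 1 - k%:Z) by ring.
  by rewrite divzMDl ?divz_small //; lia.
rewrite dvdE.
have -> : j + 1 - 1 - k%:Z = j - 1 - k%:Z + 1 by ring.
rewrite divzD1 // addrAC; congr (_ + (nat_of_bool _)%:Z).
(* As b' divides r' + s' k and is coprime to s', the condition becomes b' | j - k. *)
have -> : r' + s' * j = (r' + s' * k) + s' * (j - 1 - k%:Z + 1) by ring.
by rewrite (rpredDl _ dvdk) Gauss_dvdzr // coprimez_sym.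
Qed.
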